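(* For every $\boldsymbol{\Delta}^0_3$ set $A\subseteq 2^\omega$ there exist an open set $U$ and a closed set $C$ (subsets of $2^\omega$) such that $\Phi(U)=\Phi(C)\equiv_W A$.
   Context: $2^\omega$ is the Cantor space; $N_s=\{x: s\subset x\}$; $\mu$ is the coin-tossing measure with $\mu(N_s)=2^{-\mathrm{lh}(s)}$. For measurable $A$, $\Phi(A)=\{x: \lim_{n}\mu(A\cap N_{x\restriction n})/\mu(N_{x\restriction n})=1\}$. $\boldsymbol{\Delta}^0_3$ denotes the sets that are both $F_{\sigma\delta}$ and $G_{\delta\sigma}$. For $X,Y\subseteq 2^\omega$, $X\le_W Y$ (Wadge reducibility) means $X=f^{-1}(Y)$ for some continuous $f:2^\omega\to2^\omega$, and $X\equiv_W Y$ means $X\le_W Y$ and $Y\le_W X$. *)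

(* Defs.v *)
From Stdlib Require Import Reals List.
Import ListNotations.
Open Scope R_scope.

Definition Cantor := nat -> bool.
Definition CSet := Cantor -> Prop.

Definition prefix (x : Cantor) (n : nat) : list bool := map x (seq 0 n).

Definition N (s : list bool) : CSet := fun x => prefix x (length s) = s.

Definition is_open (U : CSet) : Prop :=
  forall x, U x -> exists n, forall y, prefix y n = prefix x n -> U y.

Definition is_closed (C : CSet) : Prop := is_open (fun x => ~ C x).

Definition is_Fsd (A : CSet) : Prop :=
  exists F : nat -> nat -> CSet,
    (forall n m, is_closed (F n m)) /\
    (forall x, A x <-> forall n, exists m, F n m x).

Definition is_Gds (A : CSet) : Prop :=
  exists G : nat -> nat -> CSet,
    (forall n m, is_open (G n m)) /\
    (forall x, A x <-> exists n, forall m, G n m x).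

Definition is_Delta03 (A : CSet) : Prop := is_Fsd A /\ is_Gds A.

(* Coin-tossing measure: mu(N_s) = 2^{-lh(s)}; mu(X) for measurable X is given by
   the (Caratheodory/Lebesgue) outer measure generated by the basic open sets:
   inf { sum_i 2^{-lh(s_i)} : X subset of union_i N_{s_i} }.
   A cover is a sequence of optional strings (None = empty piece). *)
Definition weight (o : option (list bool)) : R :=
  match o with
  | Some s => (/ 2) ^ length s
  | None => 0
  end.

Definition covers (c : nat -> option (list bool)) (X : CSet) : Prop :=
  forall x, X x -> exists i s, c i = Some s /\ N s x.

Definition cover_value (X : CSet) (l : R) : Prop :=
  exists c, covers c X /\ infinite_sum (fun i => weight (c i)) l.

Definition measure_is (X : CSet) (r : R) : Prop :=
  (forall l, cover_value X l -> r <= l) /\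
  (forall r', (forall l, cover_value X l -> r' <= l) -> r' <= r).

Definition Phi (A : CSet) : CSet := fun x =>
  exists f : nat -> R,
    (forall n, measure_is (fun y => A y /\ N (prefix x n) y) (f n)) /\
    Un_cv (fun n => f n / ((/ 2) ^ n)) 1.

Definition continuous (f : Cantor -> Cantor) : Prop :=
  forall x n, exists m, forall y, prefix y m = prefix x m -> prefix (f y) n = prefix (f x) n.

Definition wadge_le (X Y : CSet) : Prop :=
  exists f, continuous f /\ forall x, X x <-> Y (f x).

Definition wadge_equiv (X Y : CSet) : Prop := wadge_le X Y /\ wadge_le Y X.

(* Main.v *)
(** Call a position of a point [z] a check position if it is not a power of two, and let
    [K] be the set of points whose check bits all vanish: a closed null set, on which the
    bits at powers of two decode to an arbitrary point [decode z]. Since [A] is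
    F-sigma-delta there is a rank [phi] on finite strings such that [x] is in [A] iff
    [phi] tends to infinity along [x].

    A point [z] outside [K] has a first nonzero check bit, at some [m]; let [s] be the
    string decoded from [z] by then (with a delay of one bit). Put [z] in the open set [U]
    if [A] contains [N_s], or if [A] meets [N_s] and the next [phi s] bits of [z] are not
    all zero. Near a point of [K] nearly all the measure is lost within the next few check
    bits, while the decoded string, thanks to the delay, does not depend on the direction:
    the density of [U] there is about [1 - 2 ^ - phi s], and tends to 1 iff the decoded
    point is in [A]. Off [K] the set [U] is locally clopen. As [K] is null, [U] and the
    closed set [C = U \/ K] have the same density points.

    Encoding into [K] reduces [A] to [Phi U]. Conversely, decode the points of [K], and
    send [z] outside [K] to a point of [N_s] inside or outside [A], according to whether
    [z] is in [U]; the definition of [U] provides such points. *)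

From Stdlib Require Import Reals List Lra Lia ClassicalEpsilon FunctionalExtensionality.
Require Import Defs.
Import ListNotations.

(** * Prefixes and cylinders *)

Definition cyl (x : Cantor) (n : nat) : CSet :=
  fun y => forall i, (i < n)%nat -> y i = x i.

Lemma prefix_S x n : prefix x (S n) = prefix x n ++ [x n].
Proof. unfold prefix. rewrite seq_S, map_app. reflexivity. Qed.

Lemma prefix_length x n : length (prefix x n) = n.
Proof. unfold prefix. now rewrite length_map, length_seq. Qed.

Lemma prefix_eq x y n : prefix y n = prefix x n <-> cyl x n y.
Proof.
  unfold prefix. split.
  - intros H i Hi. apply (proj1 map_ext_in_iff H), in_seq. lia.
  - intros H. apply map_ext_in. intros i Hi. apply in_seq in Hi. apply H. lia.
Qed.

Lemma N_prefix x n y : N (prefix x n) y <-> cyl x n y.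
Proof. unfold N. rewrite prefix_length. apply prefix_eq. Qed.

(** * The outer measure *)

Lemma weight_ge0 o : 0 <= weight o.
Proof. destruct o; simpl; [apply pow_le; lra | lra]. Qed.

(** With bounds on partial sums, covers can be built without proving that their series converge;
    [cover_value_bound] and [cover_bound_value] pass between the two forms. *)
Definition cover_bound (X : CSet) (q : R) : Prop :=
  exists c, covers c X /\ forall n, sum_f_R0 (fun i => weight (c i)) n <= q.

Lemma weight_sum_growing c : Un_growing (sum_f_R0 (fun i => weight (c i))).
Proof. intro n. simpl. pose proof (weight_ge0 (c (S n))). lra. Qed.

Lemma cover_value_bound X l : cover_value X l -> cover_bound X l.
Proof.
  intros (c & Hc & Hl). exists c. split; [exact Hc|].
  apply growing_ineq; [apply weight_sum_growing | exact Hl].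
Qed.

Lemma cover_bound_value X q : cover_bound X q -> exists l, cover_value X l /\ l <= q.
Proof.
  intros (c & Hc & Hq).
  destruct (growing_cv _ (weight_sum_growing c)) as [l Hl].
  { exists q. intros r [n ->]. apply Hq. }
  exists l. split; [now exists c|].
  destruct (Rle_or_lt l q) as [|H]; [assumption|].
  destruct (Hl (l - q)) as [n Hn]; [lra|].
  specialize (Hn n (le_n n)). specialize (Hq n).
  unfold Rdist in Hn. apply Rabs_def2 in Hn. lra.
Qed.

Lemma measure_exists X : exists r, measure_is X r.
Proof.
  destruct (completeness (fun r => forall l, cover_value X l -> r <= l)) as [r [Hub Hlub]].
  - assert (H : cover_bound X 1).
    { exists (fun i => match i with O => Some [] | _ => None end). split.
      - intros x _. exists 0%nat, []. split; reflexivity.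
      - induction n as [|n IH]; simpl; [lra|]. lra. }
    destruct (cover_bound_value _ _ H) as (l & Hl & _).
    exists l. intros r Hr. now apply Hr.
  - exists 0. intros l (c & _ & Hl).
    apply Rle_trans with (weight (c 0%nat)); [apply weight_ge0|].
    exact (growing_ineq _ _ (weight_sum_growing c) Hl 0%nat).
  - exists r. split.
    + intros l Hl. apply Hlub. intros r' Hr'. now apply Hr'.
    + intros r' Hr'. now apply Hub.
Qed.

Definition mu (X : CSet) : R :=
  proj1_sig (constructive_indefinite_description _ (measure_exists X)).

Lemma mu_spec X : measure_is X (mu X).
Proof. unfold mu. now destruct constructive_indefinite_description. Qed.

Lemma measure_is_mu X r : measure_is X r -> r = mu X.
Proof.
  intros [H1 H2]. destruct (mu_spec X) as [H3 H4].
  apply Rle_antisym; auto.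
Qed.

Lemma mu_le_bound X q : cover_bound X q -> mu X <= q.
Proof.
  intros H. destruct (cover_bound_value _ _ H) as (l & Hl & Hlq).
  apply Rle_trans with l; [|exact Hlq]. now apply (proj1 (mu_spec X)).
Qed.

Lemma mu_approx X q : mu X < q -> cover_bound X q.
Proof.
  intros H. apply NNPP. intros Hn.
  apply (Rlt_irrefl q), Rle_lt_trans with (mu X); [|exact H].
  apply (proj2 (mu_spec X)). intros l Hl.
  destruct (Rle_or_lt q l) as [|Hlt]; [assumption|]. exfalso. apply Hn.
  destruct (cover_value_bound _ _ Hl) as (c & Hc & Hb).
  exists c. split; [exact Hc|]. intro n. specialize (Hb n). lra.
Qed.

Lemma mu_ge X q : (forall p, cover_bound X p -> q <= p) -> q <= mu X.
Proof.
  intros H. apply (proj2 (mu_spec X)). intros l Hl.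
  apply H. now apply cover_value_bound.
Qed.

Lemma mu_mono (X Y : CSet) : (forall x, X x -> Y x) -> mu X <= mu Y.
Proof.
  intros H. apply mu_ge. intros p (c & Hc & Hp).
  apply mu_le_bound. exists c. split; [|exact Hp].
  intros x Hx. apply Hc, H, Hx.
Qed.

Lemma mu_ext (X Y : CSet) : (forall x, X x <-> Y x) -> mu X = mu Y.
Proof. intros H. apply Rle_antisym; apply mu_mono; intros x; apply H. Qed.

Lemma sum_interleave (u v : nat -> R) n :
  sum_f_R0 (fun i => if Nat.even i then u (Nat.div2 i) else v (Nat.div2 i)) (2 * n + 1)
  = sum_f_R0 u n + sum_f_R0 v n.
Proof.
  induction n as [|n IH]; [simpl; lra|].
  replace (2 * S n + 1)%nat with (S (S (2 * n + 1))) by lia.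
  rewrite !tech5, IH.
  replace (S (2 * n + 1)) with (2 * S n)%nat by lia.
  rewrite Nat.even_succ, <- Nat.negb_even, Nat.even_even, Nat.div2_succ_double, Nat.div2_double.
  simpl negb. cbv iota. lra.
Qed.

Lemma mu_union (X Y : CSet) : mu (fun x => X x \/ Y x) <= mu X + mu Y.
Proof.
  apply Rle_plus_epsilon. intros e He.
  destruct (mu_approx X (mu X + e / 2)) as (c & Hc & Hp); [lra|].
  destruct (mu_approx Y (mu Y + e / 2)) as (d & Hd & Hq); [lra|].
  apply mu_le_bound.
  pose (cd := fun i => if Nat.even i then c (Nat.div2 i) else d (Nat.div2 i)).
  exists cd. split.
  - intros x [Hx|Hx].
    + destruct (Hc x Hx) as (i & s & Hi & Hs). exists (2 * i)%nat, s. split; [|exact Hs].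
      unfold cd. now rewrite Nat.even_even, Nat.div2_double.
    + destruct (Hd x Hx) as (i & s & Hi & Hs). exists (S (2 * i))%nat, s. split; [|exact Hs].
      unfold cd. now rewrite Nat.even_succ, <- Nat.negb_even, Nat.even_even, Nat.div2_succ_double.
  - intro n.
    (* Stopping at an odd index makes the interleaved sum split into partial sums of [c] and [d] of
       equal length. *)
    apply Rle_trans with (sum_f_R0 (fun i => weight (cd i)) (2 * n + 1)).
    + apply tech9; [apply weight_sum_growing | lia].
    + rewrite (sum_eq _ (fun i => if Nat.even i then weight (c (Nat.div2 i))
                                  else weight (d (Nat.div2 i)))).
      * rewrite (sum_interleave (fun i => weight (c i)) (fun i => weight (d i))).
        specialize (Hp n). specialize (Hq n). lra.
      * intros i _. unfold cd. now destruct (Nat.even i).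
Qed.

Lemma mu_le_union (X Y Z : CSet) : (forall x, X x -> Y x \/ Z x) -> mu X <= mu Y + mu Z.
Proof.
  intros H. apply Rle_trans with (2 := mu_union Y Z). now apply mu_mono.
Qed.

Lemma mu_ge0 X : 0 <= mu X.
Proof.
  apply mu_ge. intros p (c & _ & Hp).
  apply Rle_trans with (2 := Hp 0%nat). apply weight_ge0.
Qed.

(** * The measure of a cylinder *)

Lemma mu_cyl_le x n : mu (cyl x n) <= (/ 2) ^ n.
Proof.
  apply mu_le_bound.
  exists (fun i => match i with O => Some (prefix x n) | _ => None end). split.
  - intros y Hy. exists 0%nat, (prefix x n). split; [reflexivity|]. now apply N_prefix.
  - induction n0 as [|k IH]; simpl.
    + rewrite prefix_length. lra.
    + lra.
Qed.

Lemma mu_empty (X : CSet) : (forall x, ~ X x) -> mu X = 0.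
Proof.
  intros H. apply Rle_antisym; [|apply mu_ge0].
  apply mu_le_bound. exists (fun _ => None). split.
  - intros x Hx. destruct (H x Hx).
  - induction n as [|n IH]; simpl in *; lra.
Qed.

(* The measure of [N u] intersected with [N t]. *)
Fixpoint overlap (u t : list bool) : R :=
  match u, t with
  | [], _ => (/ 2) ^ length t
  | _, [] => (/ 2) ^ length u
  | a :: u', b :: t' => if Bool.eqb a b then / 2 * overlap u' t' else 0
  end.

Lemma overlap_ge0 u t : 0 <= overlap u t.
Proof.
  revert t. induction u as [|a u IH]; intros [|b t]; cbn [overlap];
    try (apply pow_le; lra).
  destruct (Bool.eqb a b); [|lra]. specialize (IH t). lra.
Qed.

Lemma overlap_nil u : overlap u [] = (/ 2) ^ length u.
Proof. now destruct u. Qed.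

Lemma overlap_refl u : overlap u u = (/ 2) ^ length u.
Proof.
  induction u as [|a u IH]; [reflexivity|]. cbn [overlap].
  rewrite Bool.eqb_reflx, IH. reflexivity.
Qed.

Lemma overlap_split u t :
  overlap u t = overlap u (t ++ [false]) + overlap u (t ++ [true]).
Proof.
  revert t. induction u as [|a u IH]; intros t.
  - cbn [overlap]. rewrite !length_app. simpl. rewrite Nat.add_1_r. simpl. lra.
  - destruct t as [|b t]; cbn [app overlap].
    + rewrite overlap_nil. destruct a; simpl; lra.
    + destruct (Bool.eqb a b); [rewrite IH|]; lra.
Qed.

Definition option_overlap (o : option (list bool)) (t : list bool) : R :=
  match o with Some u => overlap u t | None => 0 end.

Definition overlap_sum (c : nat -> option (list bool)) (t : list bool) : nat -> R :=
  sum_f_R0 (fun i => option_overlap (c i) t).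

Lemma overlap_sum_growing c t : Un_growing (overlap_sum c t).
Proof.
  intro n. unfold overlap_sum. simpl.
  assert (0 <= option_overlap (c (S n)) t); [|lra].
  destruct (c (S n)); simpl; [apply overlap_ge0|lra].
Qed.

Lemma overlap_sum_split c t n :
  overlap_sum c t n = overlap_sum c (t ++ [false]) n + overlap_sum c (t ++ [true]) n.
Proof.
  unfold overlap_sum. rewrite <- sum_plus. apply sum_eq. intros i _.
  destruct (c i); simpl; [apply overlap_split|lra].
Qed.

(** The bound [q] keeps the whole series, not only each partial sum, strictly below the measure of
    [N t]. *)
Definition underfull (c : nat -> option (list bool)) (t : list bool) : Prop :=
  exists q, q < (/ 2) ^ length t /\ forall n, overlap_sum c t n <= q.

(** If both halves failed, each would have a partial sum above [q / 2]; at the larger of the two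
    indices these would add up to more than [q] on [t]. *)
Lemma underfull_child c t :
  underfull c t -> ~ underfull c (t ++ [false]) -> underfull c (t ++ [true]).
Proof.
  intros (q & Hq & Ht) H0. apply NNPP. intros H1.
  assert (Hb : forall b, ~ underfull c (t ++ [b]) -> exists n, q / 2 < overlap_sum c (t ++ [b]) n).
  { intros b Hb. apply NNPP. intros Hn. apply Hb. exists (q / 2). split.
    - rewrite length_app, Nat.add_1_r. simpl. lra.
    - intro n. apply Rnot_lt_le. intros Hlt. apply Hn. now exists n. }
  destruct (Hb _ H0) as [n0 Hn0]. destruct (Hb _ H1) as [n1 Hn1].
  specialize (Ht (Nat.max n0 n1)). rewrite overlap_sum_split in Ht.
  pose proof (tech9 _ (overlap_sum_growing c (t ++ [false])) n0 (Nat.max n0 n1) ltac:(lia)).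
  pose proof (tech9 _ (overlap_sum_growing c (t ++ [true])) n1 (Nat.max n0 n1) ltac:(lia)).
  lra.
Qed.

(* If a cover had total weight below 1, then choosing at each step a half in which the
   cover remains deficient would lead to a point that is not covered. *)
Lemma mu_full_ge : 1 <= mu (fun _ => True).
Proof.
  apply mu_ge. intros p (c & Hc & Hp).
  destruct (Rle_or_lt 1 p) as [|Hlt]; [assumption|]. exfalso.
  pose (bit := fun t => if excluded_middle_informative (underfull c (t ++ [false]))
                        then false else true).
  pose (node := fix node n := match n with
                              | O => []
                              | S n => node n ++ [bit (node n)]
                              end).
  pose (x := fun n => bit (node n)).
  assert (Hnode : forall n, prefix x n = node n).
  { induction n as [|n IH]; [reflexivity|]. rewrite prefix_S, IH. reflexivity. }
  assert (Hu : forall n, underfull c (node n)).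
  { induction n as [|n IH].
    - exists p. split; [simpl; lra|]. intro n.
      apply Rle_trans with (2 := Hp n). apply Req_le, sum_eq. intros i _.
      destruct (c i); [apply overlap_nil|reflexivity].
    - simpl. unfold bit at 1. destruct excluded_middle_informative as [H|H]; [exact H|].
      now apply underfull_child. }
  (* The piece [s] containing [x] is itself a node, and its overlap with itself already fills that
     node. *)
  destruct (Hc x I) as (i & s & Hi & Hs).
  destruct (Hu (length s)) as (q & Hq & Hb).
  rewrite <- Hnode, Hs in Hq, Hb. specialize (Hb i).
  assert (option_overlap (c i) s <= overlap_sum c s i).
  { unfold overlap_sum. destruct i as [|i]; [simpl; lra|]. rewrite tech5.
    assert (0 <= sum_f_R0 (fun i => option_overlap (c i) s) i); [|lra].
    apply cond_pos_sum. intros k. destruct (c k); simpl; [apply overlap_ge0|lra]. }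
  rewrite Hi in H. simpl in H. rewrite overlap_refl in H. lra.
Qed.

Definition set_bit (x : Cantor) (n : nat) (b : bool) : Cantor :=
  fun i => if Nat.eqb i n then b else x i.

Lemma cyl_S_cases x n y b :
  cyl x n y -> cyl (set_bit x n b) (S n) y \/ cyl (set_bit x n (negb b)) (S n) y.
Proof.
  intros H.
  assert (E : y n = b \/ y n = negb b) by (destruct (y n), b; auto).
  destruct E as [E|E]; [left|right]; intros i Hi; unfold set_bit;
    destruct (Nat.eqb_spec i n) as [->|]; auto; apply H; lia.
Qed.

(** Lengthening the removed cylinder by one bit adds just one sibling cylinder, so the bound
    telescopes. With [a = 0] and [mu_full_ge] it bounds the measure of a cylinder from below. *)
Lemma mu_cyl_diff x a k :
  mu (fun y => cyl x a y /\ ~ cyl x (a + k) y) <= (/ 2) ^ a - (/ 2) ^ (a + k).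
Proof.
  induction k as [|k IH].
  - rewrite Nat.add_0_r, mu_empty; [lra|tauto].
  - apply Rle_trans with ((/ 2) ^ a - (/ 2) ^ (a + k) + (/ 2) ^ S (a + k)).
    + eapply Rle_trans; [|apply Rplus_le_compat;
        [exact IH | apply (mu_cyl_le (set_bit x (a + k) (negb (x (a + k)%nat))))]].
      apply mu_le_union. intros y [Hy Hn].
      destruct (classic (cyl x (a + k) y)) as [H|H]; [right|left; tauto].
      destruct (cyl_S_cases _ _ _ (x (a + k)%nat) H) as [H'|H']; [|exact H'].
      exfalso. apply Hn. rewrite Nat.add_succ_r. intros i Hi. rewrite (H' i Hi).
      unfold set_bit. destruct (Nat.eqb_spec i (a + k)) as [->|]; reflexivity.
    + rewrite Nat.add_succ_r. simpl. lra.
Qed.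

Lemma mu_cyl x n : mu (cyl x n) = (/ 2) ^ n.
Proof.
  apply Rle_antisym; [apply mu_cyl_le|].
  pose proof (mu_cyl_diff x 0 n) as H. simpl in H.
  pose proof mu_full_ge as H1.
  assert (mu (fun _ => True) <= mu (cyl x n) + mu (fun y => cyl x 0 y /\ ~ cyl x n y)).
  { apply mu_le_union. intros y _. destruct (classic (cyl x n y)); [now left|right].
    split; [|assumption]. intros i Hi. lia. }
  lra.
Qed.

(** * Densities along a point *)

Definition density (X : CSet) (x : Cantor) (n : nat) : R :=
  mu (fun y => X y /\ cyl x n y) / (/ 2) ^ n.

Lemma Phi_density X x : Phi X x <-> Un_cv (density X x) 1.
Proof.
  assert (E : forall n, mu (fun y => X y /\ N (prefix x n) y) = mu (fun y => X y /\ cyl x n y)).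
  { intro n. apply mu_ext. intro y. now rewrite N_prefix. }
  split.
  - intros (f & Hf & Hcv). intros e He. destruct (Hcv e He) as [n0 Hn0].
    exists n0. intros n Hn. specialize (Hn0 n Hn).
    rewrite (measure_is_mu _ _ (Hf n)), E in Hn0. exact Hn0.
  - intros Hcv. exists (fun n => mu (fun y => X y /\ N (prefix x n) y)). split.
    + intro n. apply mu_spec.
    + intros e He. destruct (Hcv e He) as [n0 Hn0].
      exists n0. intros n Hn. rewrite E. now apply Hn0.
Qed.
(** * A rank function for F-sigma-delta sets *)

Definition meets (X : CSet) (x : Cantor) (n : nat) : Prop :=
  exists y, cyl x n y /\ X y.

Lemma cyl_refl x n : cyl x n x.
Proof. intros i _. reflexivity. Qed.

Lemma cyl_le x y n m : (n <= m)%nat -> cyl x m y -> cyl x n y.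
Proof. intros Hnm H i Hi. apply H. lia. Qed.

Lemma cyl_iff x y n z : cyl x n y -> (cyl y n z <-> cyl x n z).
Proof.
  intros H. split; intros H' i Hi; rewrite (H' i Hi); [|symmetry]; now apply H.
Qed.

Lemma meets_local X x y n : cyl x n y -> (meets X y n <-> meets X x n).
Proof.
  intros H. unfold meets. split; intros (z & Hz & HX); exists z; split; auto;
    now apply (cyl_iff x y n z H).
Qed.

(** The index under scan after [l] stages. Each test looks only at a cylinder around [x], so the
    scan depends on a finite prefix. *)
Fixpoint candidate (F : nat -> CSet) (x : Cantor) (l : nat) : nat :=
  match l with
  | O => O
  | S l => if excluded_middle_informative (meets (F (candidate F x l)) x l)
           then candidate F x l else S (candidate F x l)
  end.

Definition stable (F : nat -> CSet) (x : Cantor) (l : nat) : Prop :=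
  meets (F (candidate F x l)) x l.

Lemma candidate_local F x y l : cyl x l y -> candidate F y l = candidate F x l.
Proof.
  induction l as [|l IH]; intros H; [reflexivity|]. simpl.
  rewrite IH by (now apply cyl_le with (2 := H); lia).
  assert (E : meets (F (candidate F x l)) y l <-> meets (F (candidate F x l)) x l)
    by (apply meets_local; apply cyl_le with (2 := H); lia).
  do 2 destruct excluded_middle_informative; tauto.
Qed.

Lemma stable_local F x y l : cyl x l y -> (stable F y l <-> stable F x l).
Proof.
  intros H. unfold stable. rewrite (candidate_local F x y l H). now apply meets_local.
Qed.

Lemma candidate_mono F x k l : (k <= l)%nat -> (candidate F x k <= candidate F x l)%nat.
Proof.
  induction 1 as [|l _ IH]; [lia|]. simpl.
  destruct excluded_middle_informative; lia.
Qed.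

(** A set containing [x] is never discarded, so it bounds the candidates and the scan moves only
    finitely often. Conversely, a final candidate meets every cylinder around [x], hence contains
    [x] because it is closed. *)
Lemma stable_iff F x :
  (forall m, is_closed (F m)) ->
  (exists m, F m x) <-> exists l0, forall l, (l0 <= l)%nat -> stable F x l.
Proof.
  intros HF. split.
  - intros [m Hm]. apply NNPP. intros Hn.
    assert (Hle : forall l, (candidate F x l <= m)%nat).
    { induction l as [|l IH]; simpl; [lia|].
      destruct excluded_middle_informative as [H|H]; [exact IH|].
      assert (candidate F x l <> m); [|lia].
      intros E. apply H. rewrite E. exists x. split; [apply cyl_refl|exact Hm]. }
    assert (Hub : forall k, exists l, (k <= candidate F x l)%nat).
    { induction k as [|k [l0 IH]]; [exists 0%nat; lia|].
      apply NNPP. intros Hk. apply Hn. exists l0. intros l Hl.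
      apply NNPP. intros Hs. apply Hk. exists (S l). simpl.
      destruct excluded_middle_informative as [H|H]; [contradiction|].
      pose proof (candidate_mono F x l0 l Hl). lia. }
    destruct (Hub (S m)) as [l Hl]. specialize (Hle l). lia.
  - intros [l0 H0]. exists (candidate F x l0).
    assert (Hc : forall l, (l0 <= l)%nat -> candidate F x l = candidate F x l0).
    { induction 1 as [|l Hl IH]; [reflexivity|]. simpl.
      destruct excluded_middle_informative as [H|H]; [exact IH|].
      destruct (H (H0 l Hl)). }
    apply NNPP. intros Hn. destruct (HF _ x Hn) as [n Hopen].
    destruct (H0 (Nat.max l0 n)) as (y & Hy & HFy); [lia|].
    rewrite Hc in HFy by lia. apply (Hopen y); [|exact HFy].
    apply prefix_eq. apply cyl_le with (2 := Hy). lia.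
Qed.

(** The greatest [k <= l] such that [P] holds below [k]. *)
Fixpoint initial_run (P : nat -> Prop) (l : nat) : nat :=
  match l with
  | O => O
  | S k => if excluded_middle_informative (forall n, (n < S k)%nat -> P n)
           then S k else initial_run P k
  end.

Lemma initial_run_ext (P Q : nat -> Prop) l :
  (forall n, P n <-> Q n) -> initial_run P l = initial_run Q l.
Proof.
  intros H. induction l as [|l IH]; [reflexivity|]. simpl. rewrite IH.
  do 2 destruct excluded_middle_informative; try reflexivity;
    exfalso; firstorder.
Qed.

Lemma initial_run_spec P l n : (n < initial_run P l)%nat -> P n.
Proof.
  induction l as [|l IH]; simpl; [lia|].
  destruct excluded_middle_informative as [H|H]; auto.
Qed.

Lemma initial_run_ge P l k :
  (k <= l)%nat -> (forall n, (n < k)%nat -> P n) -> (k <= initial_run P l)%nat.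
Proof.
  intros Hk H. induction Hk as [|l Hk IH]; simpl.
  - destruct k as [|k]; [lia|]. simpl.
    destruct excluded_middle_informative; [lia|contradiction].
  - destruct excluded_middle_informative; [lia|exact IH].
Qed.

(** A function on finite strings, represented by a point and a length; the first clause makes it
    well defined. The second reduces [A] to the sequences of naturals tending to infinity, a
    standard form of F-sigma-delta sets. *)
Definition is_rank (A : CSet) (phi : Cantor -> nat -> nat) : Prop :=
  (forall x y n, cyl x n y -> phi y n = phi x n) /\
  (forall x, A x <-> forall k, exists n0, forall n, (n0 <= n)%nat -> (k <= phi x n)%nat).

(* For each [n], scan the closed sets [F n 0, F n 1, ...], discarding a set once it misses
   the current neighbourhood of [x]: the scan stops iff [x] is in the [n]-th F-sigma set.
   The rank at stage [l] is the number of initial scans that do not move at that stage. *)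
Lemma Fsd_rank A : is_Fsd A -> exists phi, is_rank A phi.
Proof.
  intros (F & HF & HA).
  exists (fun x l => initial_run (fun n => stable (F n) x l) l). split.
  - intros x y n H. apply initial_run_ext. intros i. now apply stable_local.
  - intros x. rewrite HA. split.
    + intros H.
      assert (Hk : forall k, exists l0, forall l, (l0 <= l)%nat ->
                     forall n, (n < k)%nat -> stable (F n) x l).
      { induction k as [|k [l0 IH]]; [exists 0%nat; lia|].
        destruct (proj1 (stable_iff (F k) x (HF k)) (H k)) as [l1 H1].
        exists (Nat.max l0 l1). intros l Hl n Hn.
        destruct (Nat.eq_dec n k) as [->|]; [apply H1 | apply IH]; lia. }
      intros k. destruct (Hk k) as [l0 Hl0]. exists (Nat.max k l0). intros l Hl.
      apply initial_run_ge; [lia|]. apply Hl0. lia.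
    + intros H n. apply stable_iff; [apply HF|].
      destruct (H (S n)) as [l0 Hl0]. exists l0. intros l Hl.
      apply (initial_run_spec (fun n => stable (F n) x l) l). now apply Hl0.
Qed.

(** * Sparse coding *)

Notation lg := Nat.log2_up.

(* [lg] jumps exactly after the powers of two, so [check i] says that [i] is not one. *)
Definition check (i : nat) : Prop := lg (S i) = lg i.

Definition clean (z : Cantor) (l : nat) : Prop :=
  forall i, (i < l)%nat -> check i -> z i = false.

Definition violation (z : Cantor) (m : nat) : Prop :=
  clean z m /\ check m /\ z m = true.

Definition decode (z : Cantor) : Cantor := fun n => z (2 ^ n)%nat.

Definition encode (x : Cantor) : Cantor :=
  fun i => if Nat.eqb (lg (S i)) (lg i) then false else x (lg i).

(** Exactly [lg m] powers of two lie below [m], so that many decoded bits are visible before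
    position [m]; the last one, if any, is withheld. *)
Definition delay (m : nat) : nat := pred (lg m).

Lemma lg_S_pow2 n : lg (S (2 ^ n)) = S n.
Proof. apply Nat.log2_up_succ_pow2. lia. Qed.

Lemma lg_pow2 n : lg (2 ^ n) = n.
Proof. apply Nat.log2_up_pow2. lia. Qed.

Lemma lg_double n : (0 < n)%nat -> lg (2 * n) = S (lg n).
Proof. apply Nat.log2_up_double. Qed.

Lemma pow2_lt l i : (i < lg l)%nat -> (2 ^ i < l)%nat.
Proof.
  intros H. apply Nat.log2_up_lt_pow2; [|exact H].
  destruct l; [change (lg 0) with 0%nat in H|]; lia.
Qed.

Lemma decode_encode x : decode (encode x) = x.
Proof.
  apply functional_extensionality. intros n. unfold decode, encode.
  rewrite lg_S_pow2, lg_pow2. destruct (Nat.eqb_spec (S n) n); [lia|reflexivity].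
Qed.

Lemma encode_clean x l : clean (encode x) l.
Proof. intros i _ Hi. unfold encode. now rewrite (proj2 (Nat.eqb_eq _ _) Hi). Qed.

Lemma encode_continuous : continuous encode.
Proof.
  intros x n. exists n. intros y H. apply prefix_eq. rewrite prefix_eq in H.
  intros i Hi. unfold encode. destruct (Nat.eqb _ _); [reflexivity|].
  apply H. pose proof (Nat.log2_up_le_lin i). lia.
Qed.

Lemma clean_local z y l : cyl z l y -> clean z l -> clean y l.
Proof. intros H Hz i Hi Hc. rewrite (H i Hi). now apply Hz. Qed.

Lemma clean_S z l : clean z l -> (check l -> z l = false) -> clean z (S l).
Proof.
  intros H Hl i Hi Hc. destruct (Nat.eq_dec i l) as [->|]; [auto|]. apply H; [lia|auto].
Qed.

Lemma violation_local z y m : violation z m -> cyl z (S m) y -> violation y m.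
Proof.
  intros (Hc & Hm & Hz) H. split; [|split; [exact Hm|]].
  - apply clean_local with z; [|exact Hc]. apply cyl_le with (2 := H). lia.
  - rewrite (H m); [exact Hz|lia].
Qed.

Lemma clean_not_violation z m n : clean z n -> violation z m -> (n <= m)%nat.
Proof.
  intros Hc (_ & Hm & Hz). destruct (Nat.le_gt_cases n m) as [|H]; [assumption|].
  rewrite (Hc m H Hm) in Hz. discriminate.
Qed.

Lemma violation_unique z m n : violation z m -> violation z n -> m = n.
Proof.
  intros Hm Hn. apply Nat.le_antisymm; eapply clean_not_violation; eauto;
    [apply Hm | apply Hn].
Qed.

Lemma violation_exists z : ~ (forall l, clean z l) -> exists m, violation z m.
Proof.
  intros H. apply NNPP. intros Hn. apply H.
  induction l as [|l IH]; [intros i; lia|]. apply clean_S; [exact IH|].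
  intros Hl. destruct (z l) eqn:E; [|reflexivity].
  destruct Hn. exists l. repeat split; auto.
Qed.

(** For [m < 2 * l], [lg m] exceeds [lg l] by at most one, and the withheld bit makes up for it:
    throughout the window from [l] to [2 * l] the decoded string is fixed by the first [l] bits. *)
Lemma decode_local z y l m n :
  (l <= m < 2 * l)%nat -> (n <= delay m)%nat -> cyl z l y -> cyl (decode z) n (decode y).
Proof.
  intros Hm Hn H i Hi. apply H, pow2_lt.
  assert (lg m <= lg (2 * l))%nat by (apply Nat.log2_up_le_mono; lia).
  rewrite lg_double in H0 by lia. unfold delay in Hn. lia.
Qed.

Lemma decode_local_same z y m : cyl z m y -> cyl (decode z) (delay m) (decode y).
Proof.
  intros H i Hi. apply H, pow2_lt. unfold delay in Hi. lia.
Qed.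

Lemma set_bit_cyl z l b : cyl z l (set_bit z l b).
Proof. intros i Hi. unfold set_bit. destruct (Nat.eqb_spec i l); [lia|reflexivity]. Qed.

Lemma set_bit_same z l b : set_bit z l b l = b.
Proof. unfold set_bit. now rewrite Nat.eqb_refl. Qed.

(** * Measure lost at check bits within a window *)

Lemma half_pow_S n : (/ 2) ^ S n = / 2 * (/ 2) ^ n.
Proof. reflexivity. Qed.

Lemma half_pow_pos n : 0 < (/ 2) ^ n.
Proof. apply pow_lt. lra. Qed.

Lemma half_pow_le n m : (n <= m)%nat -> (/ 2) ^ m <= (/ 2) ^ n.
Proof.
  induction 1 as [|m _ IH]; [lra|]. rewrite half_pow_S. pose proof (half_pow_pos m). lra.
Qed.

Lemma Rdiv_le a b c : 0 < b -> a <= c * b -> a / b <= c.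
Proof.
  intros Hb H. apply Rmult_le_reg_r with b; [exact Hb|].
  unfold Rdiv. rewrite Rmult_assoc, Rinv_l; lra.
Qed.

Lemma pow2_half n : 2 ^ n * (/ 2) ^ n = 1.
Proof. rewrite <- Rpow_mult_distr, Rinv_r, pow1; lra. Qed.

(* Only [2 ^ (lg r - lg l)] clean cylinders of length [r] extend a given one of length [l]. *)
Lemma window_bound (X : CSet) q r k :
  0 <= q ->
  forall l z, (l + k = r)%nat -> clean z l ->
  (forall y m, cyl z l y -> (l <= m < r)%nat -> violation y m ->
     mu (fun w => X w /\ cyl y (S m) w) <= q * (/ 2) ^ S m) ->
  mu (fun w => X w /\ cyl z l w)
    <= q * (/ 2) ^ l + (/ 2) ^ r * (2 ^ lg r * (/ 2) ^ lg l).
Proof.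
  intros Hq. induction k as [|k IH]; intros l z Hr Hz HX.
  (* At the end of the window a clean cylinder survives and is counted with its full measure. *)
  - replace r with l by lia. rewrite pow2_half.
    apply Rle_trans with (mu (cyl z l)); [apply mu_mono; tauto|].
    rewrite mu_cyl. pose proof (Rmult_le_pos _ _ Hq (Rlt_le _ _ (half_pow_pos l))). lra.
  - assert (Hcase : check l \/ lg (S l) = S (lg l))
      by (destruct (Nat.log2_up_succ_or l); [now right|now left]).
    assert (Hsplit : mu (fun w => X w /\ cyl z l w)
              <= mu (fun w => X w /\ cyl (set_bit z l false) (S l) w)
                 + mu (fun w => X w /\ cyl (set_bit z l true) (S l) w)).
    { apply mu_le_union. intros w [HXw Hw].
      destruct (cyl_S_cases _ _ _ false Hw); [left|right]; auto. }
    assert (Hchild : forall b, clean (set_bit z l b) (S l) ->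
              mu (fun w => X w /\ cyl (set_bit z l b) (S l) w)
              <= q * (/ 2) ^ S l + (/ 2) ^ r * (2 ^ lg r * (/ 2) ^ lg (S l))).
    { intros b Hb. apply IH; [lia|exact Hb|]. intros y m Hy Hm Hv.
      apply HX; [|lia|exact Hv]. apply (cyl_iff _ _ _ _ (set_bit_cyl z l b)).
      apply cyl_le with (2 := Hy). lia. }
    assert (Hcl : forall b, (check l -> b = false) -> clean (set_bit z l b) (S l)).
    { intros b Hb. apply clean_S.
      - apply clean_local with z; [apply set_bit_cyl|exact Hz].
      - now rewrite set_bit_same. }
    destruct Hcase as [Hc|Hd].
    (* At a check position the half with bit one is a violating piece, bounded by its share of [q];
       only the other half stays clean, and [lg] does not change. *)
    + pose proof (Hchild false (Hcl false (fun _ => eq_refl))) as H0.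
      assert (H1 := HX (set_bit z l true) l (set_bit_cyl _ _ _) ltac:(lia)).
      rewrite Hc in H0. rewrite half_pow_S in *.
      assert (violation (set_bit z l true) l).
      { split; [|split; [exact Hc|apply set_bit_same]].
        apply clean_local with z; [apply set_bit_cyl|exact Hz]. }
      specialize (H1 H). lra.
    (* At a power of two both halves stay clean; the growth of [lg] by one absorbs the doubled
       number of survivors. *)
    + assert (Hnc : check l -> False) by (unfold check; lia).
      pose proof (Hchild false (Hcl false (fun _ => eq_refl))) as H0.
      pose proof (Hchild true (Hcl true (fun H => False_ind _ (Hnc H)))) as H1.
      rewrite Hd in H0, H1. rewrite !half_pow_S in *. lra.
Qed.

Lemma pow2_ge_double n : (2 * n <= 2 ^ n)%nat.
Proof.
  induction n as [|n IH]; [simpl; lia|]. rewrite Nat.pow_succ_r'.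
  destruct n; [simpl; lia|lia].
Qed.

Lemma half_pow_small e : 0 < e -> exists n0, forall n, (n0 <= n)%nat -> (/ 2) ^ n < e.
Proof.
  intros He. destruct (pow_lt_1_zero (/ 2)) with (y := e) as [n0 H]; [|exact He|].
  - rewrite Rabs_pos_eq; lra.
  - exists n0. intros n Hn. specialize (H n Hn).
    rewrite Rabs_pos_eq in H; [exact H|]. apply Rlt_le, half_pow_pos.
Qed.

Definition clean_set : CSet := fun z => forall l, clean z l.

(** With [q = 0] and the window from [0] to [2 ^ n], only [2 ^ n] cylinders of length [2 ^ n]
    survive; since [2 * n <= 2 ^ n], their total measure is at most [(/ 2) ^ n]. *)
Lemma mu_clean_set : mu clean_set = 0.
Proof.
  apply Rle_antisym; [|apply mu_ge0].
  apply Rle_plus_epsilon. intros e He. rewrite Rplus_0_l.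
  destruct (half_pow_small e He) as [n Hn]. specialize (Hn n (le_n n)).
  apply Rle_trans with ((/ 2) ^ n); [|lra].
  pose proof (window_bound clean_set 0 (2 ^ n) (2 ^ n) (Rle_refl 0) 0 (fun _ => false)
                eq_refl) as H.
  rewrite lg_pow2 in H. change (lg 0) with 0%nat in H.
  apply Rle_trans with (mu (fun w => clean_set w /\ cyl (fun _ => false) 0 w)).
  { apply mu_mono. intros w Hw. split; [exact Hw|]. intros i Hi. lia. }
  eapply Rle_trans; [apply H|].
  - intros i Hi. lia.
  - intros y m _ _ Hv. rewrite mu_empty; [rewrite Rmult_0_l; apply Rle_refl|].
    intros w [Hw Hy]. pose proof (violation_local _ _ _ Hv Hy) as Hv'.
    pose proof (clean_not_violation _ _ _ (Hw (S m)) Hv'). lia.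
  - rewrite Rmult_0_l, Rplus_0_l. change ((/ 2) ^ 0) with 1. rewrite Rmult_1_r.
    apply Rle_trans with ((/ 2) ^ (n + n) * 2 ^ n).
    + apply Rmult_le_compat_r; [apply pow_le; lra|].
      apply half_pow_le. pose proof (pow2_ge_double n). lia.
    + rewrite pow_add, Rmult_assoc, (Rmult_comm _ (2 ^ n)), pow2_half. lra.
Qed.
(** * The open set and its density points *)

Section Construction.

Context (A : CSet) (phi : Cantor -> nat -> nat) (Hphi : is_rank A phi).

(** Length of the block of zeros that cuts out of a violating piece a subcylinder of relative
    measure 2 to the minus [hole z m]. *)
Definition hole (z : Cantor) (m : nat) : nat := phi (decode z) (delay m).

(** The decoded cylinder always has a point on the side of the verdict: if true, [A] meets it; if
    false, the first alternative fails and so the complement of [A] meets it. [reduction] picks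
    these points. *)
Definition verdict (z : Cantor) (m : nat) : Prop :=
  (forall a, cyl (decode z) (delay m) a -> A a) \/
  (meets A (decode z) (delay m) /\
   exists i, (i < hole z m)%nat /\ z (S m + i)%nat = true).

Definition dense_open : CSet := fun z => exists m, violation z m /\ verdict z m.

Lemma hole_local z y m : cyl z m y -> hole y m = hole z m.
Proof. intros H. apply Hphi. now apply decode_local_same. Qed.

Lemma verdict_local z y m : cyl z (S m + hole z m) y -> (verdict y m <-> verdict z m).
Proof.
  intros H.
  assert (H0 : cyl z m y) by (apply cyl_le with (2 := H); lia).
  assert (Hd := decode_local_same z y m H0).
  unfold verdict. rewrite (hole_local z y m H0), (meets_local A _ _ _ Hd).
  assert (E : (forall a, cyl (decode y) (delay m) a -> A a)
              <-> (forall a, cyl (decode z) (delay m) a -> A a)).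
  { split; intros Ha a Hc; apply Ha; now apply (cyl_iff _ _ _ a Hd). }
  assert (E' : (exists i, (i < hole z m)%nat /\ y (S m + i)%nat = true)
              <-> (exists i, (i < hole z m)%nat /\ z (S m + i)%nat = true)).
  { split; intros (i & Hi & Hb); exists i; split; auto;
      [rewrite <- H | rewrite H]; auto; lia. }
  tauto.
Qed.

Lemma dense_open_verdict z m : violation z m -> (dense_open z <-> verdict z m).
Proof.
  intros Hv. split; [|now exists m]. intros (n & Hn & H).
  now rewrite (violation_unique z m n Hv Hn).
Qed.

Lemma dense_open_local z y m :
  violation z m -> cyl z (S m + hole z m) y -> (dense_open y <-> dense_open z).
Proof.
  intros Hv H. rewrite (dense_open_verdict z m Hv), (dense_open_verdict y m).
  - now apply verdict_local.
  - apply violation_local with z; [exact Hv|]. apply cyl_le with (2 := H). lia.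
Qed.

Lemma dense_open_is_open : is_open dense_open.
Proof.
  intros z (m & Hm & Hz). exists (S m + hole z m)%nat. intros y Hy. apply prefix_eq in Hy.
  apply (dense_open_local z y m Hm Hy). now exists m.
Qed.

Lemma dense_closed_is_closed : is_closed (fun z => dense_open z \/ clean_set z).
Proof.
  intros z Hz. destruct (violation_exists z) as [m Hm]; [firstorder|].
  exists (S m + hole z m)%nat. intros y Hy. apply prefix_eq in Hy.
  intros [H|H].
  - apply Hz. left. now apply (dense_open_local z y m Hm Hy).
  - assert (violation y m).
    { apply violation_local with z; [exact Hm|]. apply cyl_le with (2 := Hy). lia. }
    pose proof (clean_not_violation _ _ _ (H (S m)) H0). lia.
Qed.

(** * Densities of the open set *)

Definition clear_after (z : Cantor) (n : nat) : Cantor :=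
  fun i => if Nat.ltb i n then z i else false.

Lemma clear_after_cyl z n : cyl z n (clear_after z n).
Proof.
  intros i Hi. unfold clear_after. now rewrite (proj2 (Nat.ltb_lt _ _) Hi).
Qed.

(** Absence of a one in the block is membership in a single longer cylinder, to which the measure
    formulas for cylinders apply. *)
Lemma cyl_clear_after z n k w :
  cyl z n w ->
  (cyl (clear_after z n) (n + k) w <-> ~ exists i, (i < k)%nat /\ w (n + i)%nat = true).
Proof.
  intros Hw. split.
  - intros H (i & Hi & Hb). rewrite H in Hb by lia. unfold clear_after in Hb.
    destruct (Nat.ltb_spec (n + i) n); [lia|discriminate].
  - intros H i Hi. unfold clear_after. destruct (Nat.ltb_spec i n); [now apply Hw|].
    destruct (w i) eqn:E; [|reflexivity]. destruct H. exists (i - n)%nat.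
    split; [lia|]. now replace (n + (i - n))%nat with i by lia.
Qed.

(** As [A] meets the decoded cylinder, a point of the piece outside [dense_open] must have an
    all-zero block. *)
Lemma piece_complement_le y m :
  violation y m -> meets A (decode y) (delay m) ->
  mu (fun w => ~ dense_open w /\ cyl y (S m) w) <= (/ 2) ^ hole y m * (/ 2) ^ S m.
Proof.
  intros Hv HA. rewrite <- pow_add, Nat.add_comm.
  rewrite <- (mu_cyl (clear_after y (S m))). apply mu_mono. intros w [Hw Hy].
  apply (cyl_clear_after y (S m) _ w Hy). intros H. apply Hw. exists m.
  split; [now apply violation_local with y|]. right.
  assert (H0 : cyl y m w) by (apply cyl_le with (2 := Hy); lia).
  rewrite (hole_local y w m H0). split; [|exact H].
  now apply (meets_local A _ _ _ (decode_local_same y w m H0)).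
Qed.

(** As [A] does not contain the decoded cylinder, only the second alternative of [verdict] can hold,
    so [dense_open] misses the subcylinder with the all-zero block. *)
Lemma piece_le y m :
  violation y m -> meets (fun a => ~ A a) (decode y) (delay m) ->
  mu (fun w => dense_open w /\ cyl y (S m) w) <= (1 - (/ 2) ^ hole y m) * (/ 2) ^ S m.
Proof.
  intros Hv (a & Ha & HA).
  apply Rle_trans with ((/ 2) ^ S m - (/ 2) ^ (S m + hole y m)).
  - eapply Rle_trans; [|apply (mu_cyl_diff (clear_after y (S m)))].
    apply mu_mono. intros w [Hw Hy]. split.
    + now apply (cyl_iff y _ _ w (clear_after_cyl y (S m))).
    + rewrite (cyl_clear_after y (S m) _ w Hy). intros Hn. apply Hn.
      apply (dense_open_verdict w m) in Hw; [|now apply violation_local with y].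
      assert (H0 : cyl y m w) by (apply cyl_le with (2 := Hy); lia).
      destruct Hw as [Hw|[_ Hw]].
      * destruct HA. apply Hw.
        now apply (cyl_iff _ _ _ a (decode_local_same y w m H0)).
      * now rewrite (hole_local y w m H0) in Hw.
  - rewrite pow_add. lra.
Qed.

Lemma density_le_1 X x n : density X x n <= 1.
Proof.
  unfold density. apply Rdiv_le; [apply half_pow_pos|]. rewrite Rmult_1_l.
  rewrite <- (mu_cyl x). apply mu_mono. tauto.
Qed.

(** [window_bound] yields upper bounds only; subadditivity turns one for the complement into a lower
    bound on the density. *)
Lemma density_ge_complement X x n :
  1 - mu (fun y => ~ X y /\ cyl x n y) / (/ 2) ^ n <= density X x n.
Proof.
  unfold density. pose proof (half_pow_pos n) as Hn.
  assert (H : (/ 2) ^ n <= mu (fun y => X y /\ cyl x n y) + mu (fun y => ~ X y /\ cyl x n y)).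
  { rewrite <- (mu_cyl x). apply mu_le_union. intros y Hy. destruct (classic (X y)); tauto. }
  apply Rmult_le_reg_r with ((/ 2) ^ n); [exact Hn|].
  unfold Rdiv. rewrite Rmult_minus_distr_r, !Rmult_assoc, Rinv_l by lra. lra.
Qed.

(** The window from [S (2 ^ n)] to [2 ^ S n] contains no power of two: the delay is [n] throughout
    it, and only one clean cylinder survives, of relative measure 2 to the minus [2 ^ n - 1]. *)
Lemma density_upper z n k :
  clean_set z -> ~ A (decode z) -> (phi (decode z) n <= k)%nat ->
  density dense_open z (S (2 ^ n)) <= 1 - (/ 2) ^ k + (/ 2) ^ (2 ^ n - 1).
Proof.
  intros Hz HA Hk.
  assert (Hn : (0 < 2 ^ n)%nat) by (pose proof (Nat.pow_nonzero 2 n); lia).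
  assert (Hr : (S (2 ^ n) + (2 ^ n - 1) = 2 ^ S n)%nat) by (rewrite Nat.pow_succ_r'; lia).
  assert (Hq : 0 <= 1 - (/ 2) ^ k)
    by (pose proof (half_pow_le 0 k (Nat.le_0_l k)); simpl in H; lra).
  unfold density. apply Rdiv_le; [apply half_pow_pos|].
  eapply Rle_trans; [apply (window_bound dense_open (1 - (/ 2) ^ k) _ _ Hq _ z Hr)|].
  - apply Hz.
  - intros y m Hy Hm Hv.
    assert (Hlg : delay m = n).
    { unfold delay. pose proof (Nat.log2_up_le_mono _ _ (proj1 Hm)) as H1.
      pose proof (Nat.log2_up_le_mono m (2 ^ S n) ltac:(lia)) as H2.
      rewrite lg_S_pow2 in H1. rewrite lg_pow2 in H2. lia. }
    assert (Hd : cyl (decode z) (delay m) (decode y)).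
    { apply decode_local with (m := m) (3 := Hy); [rewrite Nat.pow_succ_r' in Hm|]; lia. }
    eapply Rle_trans; [apply piece_le; [exact Hv|]|].
    + exists (decode z). split; [|exact HA]. apply (cyl_iff _ _ _ _ Hd), cyl_refl.
    + apply Rmult_le_compat_r; [apply Rlt_le, half_pow_pos|].
      unfold hole. rewrite (proj1 Hphi _ _ _ Hd), Hlg.
      pose proof (half_pow_le _ _ Hk). lra.
  - rewrite lg_S_pow2, lg_pow2, pow2_half, Rmult_1_r, <- Hr, (pow_add (/ 2) (S (2 ^ n))).
    lra.
Qed.

(** Here the window runs from an arbitrary [l] to [2 * l]. It contains one power of two, so two
    clean cylinders survive, each of relative measure [(/ 2) ^ l]. *)
Lemma density_lower z l k :
  (0 < l)%nat -> clean_set z -> A (decode z) ->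
  (forall n, (pred (lg l) <= n)%nat -> (k <= phi (decode z) n)%nat) ->
  1 - ((/ 2) ^ k + 2 * (/ 2) ^ l) <= density dense_open z l.
Proof.
  intros Hl Hz HA Hk. eapply Rle_trans; [|apply density_ge_complement].
  apply Rplus_le_compat_l, Ropp_le_contravar. apply Rdiv_le; [apply half_pow_pos|].
  eapply Rle_trans.
  - apply (window_bound (fun w => ~ dense_open w) ((/ 2) ^ k) (2 * l) l); [|lia|apply Hz|].
    + apply Rlt_le, half_pow_pos.
    + intros y m Hy Hm Hv.
      assert (Hd : cyl (decode z) (delay m) (decode y))
        by (now apply decode_local with (m := m) (3 := Hy)).
      eapply Rle_trans; [apply piece_complement_le; [exact Hv|]|].
      * exists (decode z). split; [|exact HA]. apply (cyl_iff _ _ _ _ Hd), cyl_refl.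
      * apply Rmult_le_compat_r; [apply Rlt_le, half_pow_pos|].
        apply half_pow_le. unfold hole. rewrite (proj1 Hphi _ _ _ Hd). apply Hk.
        unfold delay. apply Nat.pred_le_mono, Nat.log2_up_le_mono. lia.
  - rewrite lg_double by exact Hl. replace (2 * l)%nat with (l + l)%nat by lia.
    rewrite pow_add. change (2 ^ S (lg l)) with (2 * 2 ^ lg l).
    rewrite (Rmult_assoc 2), pow2_half. lra.
Qed.

Lemma Phi_clean z : clean_set z -> (Phi dense_open z <-> A (decode z)).
Proof.
  intros Hz. rewrite Phi_density. split.
  - intros Hcv. apply NNPP. intros HA.
    assert (Hb : exists k, forall n0, exists n, (n0 <= n)%nat /\ (phi (decode z) n <= k)%nat).
    { apply NNPP. intros Hn. apply HA, Hphi. intros k. apply NNPP. intros Hk.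
      apply Hn. exists k. intros n0. apply NNPP. intros Hn0. apply Hk. exists n0.
      intros n Hle. apply NNPP. intros Hlt. apply Hn0. exists n. lia. }
    destruct Hb as [k Hk].
    (* Half of the gap [(/ 2) ^ k] suffices: for the [n] chosen next, [2 ^ n - 1] is at least [S k],
       so the error term of [density_upper] takes at most the other half. *)
    destruct (Hcv ((/ 2) ^ S k)) as [n0 Hn0]; [apply half_pow_pos|].
    destruct (Hk (n0 + S (S k))%nat) as (n & Hn & Hphin).
    pose proof (Nat.pow_gt_lin_r 2 n ltac:(lia)) as Hlin.
    specialize (Hn0 (S (2 ^ n)) ltac:(lia)).
    unfold Rdist in Hn0. apply Rabs_def2 in Hn0.
    pose proof (density_upper z n k Hz HA Hphin) as Hd.
    pose proof (half_pow_le (S k) (2 ^ n - 1) ltac:(lia)) as Hh.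
    rewrite half_pow_S in *. lra.
  - intros HA e He.
    (* The error of [density_lower] is one power with exponent [k] and two with exponent [l], hence
       below three quarters of [e]. *)
    destruct (half_pow_small (e / 4)) as [k Hk]; [lra|].
    destruct (proj1 (proj2 Hphi _) HA k) as [n0 Hn0].
    (* The successor makes up for the [pred] in the delay: beyond this point the decoded length is
       at least [n0]. *)
    exists (2 ^ S (n0 + k))%nat. intros l Hl.
    pose proof (Nat.pow_gt_lin_r 2 (S (n0 + k)) ltac:(lia)) as Hlin.
    assert (Hlg : (S (n0 + k) <= lg l)%nat).
    { rewrite <- (lg_pow2 (S (n0 + k))). now apply Nat.log2_up_le_mono. }
    pose proof (density_lower z l k ltac:(lia) Hz HA) as H1.
    pose proof (density_le_1 dense_open z l) as H2.
    pose proof (Hk k (le_n k)) as H3. pose proof (Hk l ltac:(lia)) as H4.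
    unfold Rdist. apply Rabs_def1; [lra|].
    assert (1 - ((/ 2) ^ k + 2 * (/ 2) ^ l) <= density dense_open z l); [|lra].
    apply H1. intros n Hn. apply Hn0. lia.
Qed.

Lemma Phi_violation z m : violation z m -> (Phi dense_open z <-> dense_open z).
Proof.
  intros Hv. rewrite Phi_density.
  assert (Hloc : forall n, (S m + hole z m <= n)%nat ->
            forall y, cyl z n y -> (dense_open y <-> dense_open z)).
  { intros n Hn y Hy. apply dense_open_local with m; [exact Hv|].
    now apply cyl_le with (2 := Hy). }
  split.
  - intros Hcv. apply NNPP. intros Hz.
    destruct (Hcv 1) as [n0 Hn0]; [lra|].
    set (n := Nat.max n0 (S m + hole z m)).
    specialize (Hn0 n ltac:(lia)). unfold density in Hn0.
    rewrite mu_empty in Hn0.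
    + unfold Rdist, Rdiv in Hn0. rewrite Rmult_0_l, Rabs_left in Hn0; lra.
    + intros y [Hy Hc]. apply Hz. apply (Hloc n ltac:(lia) y Hc). exact Hy.
  - intros Hz e He. exists (S m + hole z m)%nat. intros n Hn.
    unfold density. rewrite (mu_ext _ (cyl z n)).
    + rewrite mu_cyl. unfold Rdiv. rewrite Rinv_r by (pose proof (half_pow_pos n); lra).
      unfold Rdist. rewrite Rminus_diag, Rabs_R0. lra.
    + intros y. pose proof (Hloc n Hn y). tauto.
Qed.

Lemma Phi_open_closed z :
  Phi dense_open z <-> Phi (fun y => dense_open y \/ clean_set y) z.
Proof.
  rewrite !Phi_density.
  assert (E : forall n, density (fun y => dense_open y \/ clean_set y) z n
                        = density dense_open z n).
  { intro n. unfold density. f_equal. apply Rle_antisym; [|apply mu_mono; tauto].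
    rewrite <- Rplus_0_r, <- mu_clean_set. apply mu_le_union. tauto. }
  split; intros H e He; destruct (H e He) as [n0 Hn0]; exists n0; intros n Hn;
    specialize (Hn0 n Hn); now rewrite E in *.
Qed.

(** * The two Wadge reductions *)

Lemma le_Phi : wadge_le A (Phi dense_open).
Proof.
  exists encode. split; [exact encode_continuous|]. intros x.
  rewrite Phi_clean, decode_encode; [tauto|]. intros l. apply encode_clean.
Qed.

(** The choice depends on the string alone, so points with the same decoded string get the same
    image; continuity off the clean set rests on this. *)
Definition pick (X : CSet) (s : list bool) : Cantor :=
  epsilon (inhabits (fun _ => false)) (fun a => N s a /\ X a).

Definition first_violation (z : Cantor) : nat := epsilon (inhabits 0%nat) (violation z).

Definition decode_at (z : Cantor) (m : nat) : list bool := prefix (decode z) (delay m).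

(* Off the clean set, [reduction] leaves the coded path at the first violation: the points
   are chosen so that membership in [A] reflects membership in [dense_open]. *)
Definition reduction (z : Cantor) : Cantor :=
  if excluded_middle_informative (clean_set z) then decode z
  else if excluded_middle_informative (dense_open z)
       then pick A (decode_at z (first_violation z))
       else pick (fun a => ~ A a) (decode_at z (first_violation z)).

Lemma pick_spec X x n : meets X x n -> cyl x n (pick X (prefix x n)) /\ X (pick X (prefix x n)).
Proof.
  intros (a & Ha & HX).
  assert (H : exists a, N (prefix x n) a /\ X a) by (exists a; now rewrite N_prefix).
  apply (epsilon_spec (inhabits (fun _ => false))) in H. now rewrite N_prefix in H.
Qed.

Lemma reduction_violation z m :
  violation z m ->
  reduction z = if excluded_middle_informative (dense_open z)
                then pick A (decode_at z m) else pick (fun a => ~ A a) (decode_at z m).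
Proof.
  intros Hv. unfold reduction.
  assert (E : first_violation z = m).
  { apply (violation_unique z); [|exact Hv]. unfold first_violation.
    apply epsilon_spec. now exists m. }
  rewrite E. destruct excluded_middle_informative as [H|H]; [|reflexivity].
  pose proof (clean_not_violation _ _ _ (H (S m)) Hv). lia.
Qed.

Lemma reduction_spec z m :
  violation z m ->
  cyl (decode z) (delay m) (reduction z) /\ (A (reduction z) <-> dense_open z).
Proof.
  intros Hv. rewrite (reduction_violation z m Hv).
  pose proof (dense_open_verdict z m Hv) as Hz.
  destruct excluded_middle_informative as [H|H]; unfold decode_at.
  - assert (Hm : meets A (decode z) (delay m)).
    { apply Hz in H. destruct H as [H|[H _]]; [|exact H].
      exists (decode z). split; [apply cyl_refl|apply H, cyl_refl]. }
    destruct (pick_spec _ _ _ Hm). tauto.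
  - assert (Hm : meets (fun a => ~ A a) (decode z) (delay m)).
    { apply NNPP. intros Hn. apply H, Hz. left. intros a Ha. apply NNPP. intros HA.
      apply Hn. now exists a. }
    destruct (pick_spec _ _ _ Hm). tauto.
Qed.

Lemma reduction_continuous : continuous reduction.
Proof.
  intros z n. destruct (classic (clean_set z)) as [Hz|Hz].
  (* A nearby point that is not clean has its violation at [2 ^ S n] or later, where the delay is at
     least [n]; its image therefore still agrees with its decoded point on [n] bits. *)
  - exists (2 ^ S n)%nat. intros y Hy. apply prefix_eq in Hy. apply prefix_eq.
    assert (Hd : cyl (decode z) n (decode y)).
    { intros i Hi. apply Hy. apply Nat.pow_lt_mono_r; lia. }
    replace (reduction z) with (decode z)
      by (unfold reduction; destruct excluded_middle_informative; tauto).
    destruct (classic (clean_set y)) as [Hc|Hc].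
    + replace (reduction y) with (decode y); [exact Hd|].
      unfold reduction; destruct excluded_middle_informative; tauto.
    + destruct (violation_exists y Hc) as [m Hm].
      assert (Hle : (2 ^ S n <= m)%nat).
      { apply clean_not_violation with y; [|exact Hm].
        apply clean_local with z; [exact Hy|apply Hz]. }
      apply Nat.log2_up_le_mono in Hle. rewrite lg_pow2 in Hle.
      apply (cyl_iff _ _ _ _ Hd).
      apply cyl_le with (delay m); [unfold delay; lia|].
      now apply reduction_spec.
  (* Off the clean set [reduction] is locally constant: near [z] the violation, the decoded string
     and membership in [dense_open] are all fixed. *)
  - destruct (violation_exists z Hz) as [m Hm]. exists (S m + hole z m)%nat.
    intros y Hy. apply prefix_eq in Hy. f_equal.
    assert (H0 : cyl z (S m) y) by (apply cyl_le with (2 := Hy); lia).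
    rewrite (reduction_violation z m Hm),
      (reduction_violation y m (violation_local _ _ _ Hm H0)).
    replace (decode_at y m) with (decode_at z m).
    + pose proof (dense_open_local z y m Hm Hy).
      do 2 destruct excluded_middle_informative; tauto.
    + symmetry. apply prefix_eq, decode_local_same. apply cyl_le with (2 := H0). lia.
Qed.

Lemma Phi_le : wadge_le (Phi dense_open) A.
Proof.
  exists reduction. split; [exact reduction_continuous|]. intros z.
  destruct (classic (clean_set z)) as [Hz|Hz].
  - rewrite Phi_clean by exact Hz. unfold reduction.
    destruct excluded_middle_informative; tauto.
  - destruct (violation_exists z Hz) as [m Hm].
    rewrite (Phi_violation z m Hm). symmetry. now apply reduction_spec with (m := m).
Qed.

End Construction.

Theorem theorem1p4 :
  forall A : CSet, is_Delta03 A ->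
    exists U C : CSet,
      is_open U /\ is_closed C /\
      (forall x, Phi U x <-> Phi C x) /\
      wadge_equiv (Phi U) A.
Proof.
  intros A [HA _]. destruct (Fsd_rank A HA) as [phi Hphi].
  exists (dense_open A phi), (fun z => dense_open A phi z \/ clean_set z).
  repeat split.
  - now apply dense_open_is_open.
  - now apply dense_closed_is_closed.
  - apply Phi_open_closed.
  - apply Phi_open_closed.
  - now apply Phi_le.
  - now apply le_Phi.
Qed.
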